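(* Let $\mu>0$, let $X_1,\dots,X_N$ be i.i.d. Rayleigh random variables with second moment $\mu$, and put $\widehat{\mu}_N=\frac1N\sum_{i=1}^N X_i^2$. (i) Let $\varepsilon,\delta\in(0,1)$. If $N>\frac{2(3+2\varepsilon)\ln\frac2\delta}{3\varepsilon^2}$, then $$\Pr\left\{\frac{\widehat{\mu}_N}{1+\varepsilon}<\mu<\frac{\widehat{\mu}_N}{1-\varepsilon}\right\}>1-\delta. \qquad ( * )$$ (ii) Let $\delta\in(0,1)$, $N>\frac{10}{3}\ln\frac2\delta$, and $$\varepsilon=\frac{2\ln\frac2\delta}{3N}\left(1+\sqrt{1+\frac{9N}{2\ln\frac2\delta}}\right).$$ Then the inequality $( * )$ holds.
   Context: A Rayleigh random variable with second moment $\mu>0$ is a real random variable with density $f(x)=\frac{2x}{\mu}e^{-x^2/\mu}$ for $x\ge 0$ and $f(x)=0$ for $x<0$. The sample size $N$ is a positive integer. *)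

(* Defs.v *)
From mathcomp Require Export all_boot all_order all_algebra.
From mathcomp Require Export all_classical all_reals all_analysis.
Export Order.TTheory GRing.Theory Num.Theory.
Export numFieldNormedType.Exports.

Set Implicit Arguments.
Unset Strict Implicit.
Unset Printing Implicit Defensive.

Local Open Scope classical_set_scope.
Local Open Scope ring_scope.

(* Taking [A i := setT] for some indices reduces every subfamily to the full
   one; the rule is nevertheless required for every [J], as in the textbook
   definition. *)
Definition mutually_independent (R : realType) (d : measure_display)
    (T : measurableType d) (P : probability T R) (I : finType)
    (X : I -> {RV P >-> R}) : Prop :=
  forall (J : {set I}) (A : I -> set R),
    (forall i, measurable (A i)) ->
    (P (\bigcap_(i in [set` J]) (X i @^-1` A i)) =
     \prod_(i in J) P (X i @^-1` A i))%E.

Definition rayleigh_pdf (R : realType) (mu x : R) : R :=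
  if 0 <= x then 2 * x / mu * expR (- (x ^+ 2 / mu)) else 0.

(* [rayleigh_pdf mu] is the density of the law of [X] with respect to the
   Lebesgue measure; the parameter is the second moment of the law, not the
   scale [sigma] of the other usual convention, for which [mu = 2 sigma^2]. *)
Definition is_rayleigh (R : realType) (d : measure_display)
    (T : measurableType d) (P : probability T R) (mu : R)
    (X : {RV P >-> R}) : Prop :=
  forall A : set R, measurable A ->
    (distribution P X A =
     \int[lebesgue_measure]_(x in A) (rayleigh_pdf mu x)%:E)%E.

Definition second_moment_estimator (R : realType) (d : measure_display)
    (T : measurableType d) (P : probability T R) (N : nat)
    (X : 'I_N -> {RV P >-> R}) (w : T) : R :=
  N%:R^-1 * \sum_(i < N) (X i w) ^+ 2.

(* Main.v *)
Require Import Defs.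
From HB Require Import structures.
From mathcomp Require Import measurable_realfun ring lra.
Import HBNNSimple.

Local Open Scope classical_set_scope.
Local Open Scope ring_scope.

(* Each [X i ^+ 2 / mu] is exponentially distributed with mean [1], so that
   ['E[expR (r * X i ^+ 2)] = (1 - r * mu)^-1].  Chernoff's bound with the
   optimal [r] then gives
   [P (u * (Z - mu * (1 + u)) >= 0) <= ((1 + u) * expR (- u)) ^+ N] for the
   estimator [Z] and any [u > -1].  Taking [u = eps] and [u = - eps] and
   bounding the logarithms makes each tail at most [delta / 2], the lower one
   strictly; hence (i) already holds for a non-strict bound on [N], and in (ii)
   [eps] is the positive root of the corresponding quadratic equation. *)

(** * Weighted integrals of functions of a random element *)

(** Simple-function case of the transfer lemma below: [f \o p] is split over the finitely many
    fibres of [f], and only integrals of [g] over preimages under [p] remain. *)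
Lemma ge0_integral_fimfun_weighted (R : realType) d d' (S : measurableType d)
    (T : measurableType d') (m : {measure set S -> \bar R}) (p : S -> T)
    (g : S -> \bar R) (f : {nnsfun T >-> R}) :
  measurable_fun [set: S] p -> measurable_fun [set: S] g ->
  (forall x, 0 <= g x)%E ->
  (\int[m]_x ((f (p x))%:E * g x) =
   \sum_(y \in range f) y%:E * \int[m]_(x in p @^-1` (f @^-1` [set y])) g x)%E.
Proof.
move=> mp mg g0.
have mpf y : measurable (p @^-1` (f @^-1` [set y])).
  by rewrite -[X in measurable X]setTI; exact: mp.
transitivity (\int[m]_x \sum_(y \in range f)
    (y%:E * ((g \_ (p @^-1` (f @^-1` [set y]))) x)))%E.
  apply: eq_integral => x _.
  rewrite fimfunE -fsumEFin// ge0_mule_fsuml; last first.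
    by move=> y; exact: nnfun_muleindic_ge0.
  apply: eq_fsbigr => y _; rewrite EFinM -muleA; congr (_ * _)%E.
  rewrite indicE patchE.
  have -> : (p x \in f @^-1` [set y]) = (x \in p @^-1` (f @^-1` [set y])).
    by apply/idP/idP; rewrite !inE.
  by case: ifP; rewrite ?mul1e ?mul0e.
have mr y : measurable_fun [set: S] (g \_ (p @^-1` (f @^-1` [set y]))).
  apply/(measurable_restrictT _ _).1 => //; exact: measurable_funTS.
rewrite ge0_integral_fsum//=.
- apply: eq_fsbigr => y /set_mem [t _ <-].
  rewrite ge0_integralZl//=; last 2 first.
    by move=> x _; rewrite patchE; case: ifP.
    by rewrite lee_fin.
  by rewrite -integral_mkcond.
- by move=> y; apply: emeasurable_funM => //; exact: measurable_cst.
- move=> y x _; rewrite patchE; case: ifPn; rewrite ?mule0// inE /= => <-.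
  by rewrite mule_ge0// lee_fin.
Qed.

(** The pushforward of [g1 m1] under [p1] and that of [g2 m2] under [p2] are the same measure on
    [T], so they integrate simple functions alike, and by monotone convergence all nonnegative ones.
    Two weights on two spaces cover both uses: a law given by a density, and a factor independent of
    the remaining ones. *)
Lemma ge0_integral_weighted_pushforward (R : realType) d1 d2 d
    (S1 : measurableType d1) (S2 : measurableType d2) (T : measurableType d)
    (m1 : {measure set S1 -> \bar R}) (m2 : {measure set S2 -> \bar R})
    (p1 : S1 -> T) (p2 : S2 -> T) (g1 : S1 -> \bar R) (g2 : S2 -> \bar R)
    (f : T -> \bar R) :
  measurable_fun [set: S1] p1 -> measurable_fun [set: S2] p2 ->
  measurable_fun [set: S1] g1 -> measurable_fun [set: S2] g2 ->
  (forall x, 0 <= g1 x)%E -> (forall x, 0 <= g2 x)%E ->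
  (forall A, measurable A -> \int[m1]_(x in p1 @^-1` A) g1 x =
                             \int[m2]_(x in p2 @^-1` A) g2 x)%E ->
  measurable_fun [set: T] f -> (forall y, 0 <= f y)%E ->
  (\int[m1]_x (f (p1 x) * g1 x) = \int[m2]_x (f (p2 x) * g2 x))%E.
Proof.
move=> mp1 mp2 mg1 mg2 g1_ge0 g2_ge0 g12 mf f0.
pose h := nnsfun_approx measurableT mf.
have approx e (S : measurableType e) (m : {measure set S -> \bar R})
    (p : S -> T) (g : S -> \bar R) :
    measurable_fun [set: S] p -> measurable_fun [set: S] g ->
    (forall x, 0 <= g x)%E ->
    (\int[m]_x (f (p x) * g x) =
     limn (fun n => \int[m]_x ((h n (p x))%:E * g x)))%E.
  move=> mp mg g0; rewrite -monotone_convergence//.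
  - apply: eq_integral => x _; apply/esym/cvg_lim => //.
    (* [cvgeM] excludes limits of the form [0 * +oo]. *)
    have [g0x|gN0] := eqVneq (g x) 0%E.
      rewrite g0x mule0 (_ : (fun n => _) = cst 0%E); first exact: cvg_cst.
      by apply/funext => n; rewrite mule0.
    have [f0x|fN0] := eqVneq (f (p x)) 0%E.
      rewrite f0x mul0e (_ : (fun n => _) = cst 0%E); first exact: cvg_cst.
      apply/funext => n; have : ((h n (p x))%:E <= f (p x))%E.
        by rewrite nnsfun_approxE le_approx.
      rewrite f0x lee_fin => hn0.
      by rewrite (_ : h n (p x) = 0) ?mul0e//; apply/eqP; rewrite eq_le hn0 /=.
    apply: cvgeM; first by rewrite mule_defE (negbTE gN0) (negbTE fN0).
      exact: cvg_nnsfun_approx.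
    exact: cvg_cst.
  - move=> n; apply: emeasurable_funM => //; apply/measurable_EFinP.
    exact: measurableT_comp.
  - by move=> n x _; rewrite mule_ge0// lee_fin.
  - move=> x _ a b ab; rewrite lee_wpmul2r// lee_fin.
    exact/lefP/nd_nnsfun_approx.
rewrite (approx _ _ m1)// (approx _ _ m2)//; congr (limn _); apply/funext => n.
rewrite !ge0_integral_fimfun_weighted//; apply: eq_fsbigr => y _.
by rewrite g12.
Qed.

(** * Expectation of a product of independent factors *)

Lemma expectation_prod_independent (R : realType) (d : measure_display)
    (T : measurableType d) (P : probability T R) (I : finType)
    (X : I -> {RV P >-> R}) (f : I -> R -> R) :
  mutually_independent X ->
  (forall i, measurable_fun [set: R] (f i)) -> (forall i x, 0 <= f i x) ->
  (\int[P]_w (\prod_i f i (X i w))%:E = \prod_i \int[P]_w (f i (X i w))%:E)%E.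
Proof.
move=> Xindep.
(* Independence is the case of indicators; the indicators are then traded for
   arbitrary functions one factor at a time, [s] listing those done. *)
suff prod_on (s : seq I) : forall g : I -> R -> R,
    (forall i, i \notin s -> exists2 A, measurable A & g i = \1_A) ->
    (forall i, measurable_fun [set: R] (g i)) -> (forall i x, 0 <= g i x) ->
    (\int[P]_w (\prod_i g i (X i w))%:E =
     \prod_i \int[P]_w (g i (X i w))%:E)%E.
  by apply: (prod_on (enum I)) => i; rewrite mem_enum.
have mX (A : set R) i : measurable A -> measurable (X i @^-1` A).
  by move=> mA; rewrite -[X in measurable X]setTI; exact: measurable_funPT.
have int_indic i (A : set R) : measurable A ->
    (\int[P]_w (\1_A (X i w))%:E = P (X i @^-1` A))%E.
  move=> mA; rewrite -(setIT (X i @^-1` A)) -integral_indic//; exact: mX.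
elim: s => [g gA mg g0|x s IH g gA mg g0].
  have /boolp.choice[A AP] : forall i, exists A, measurable A /\ g i = \1_A.
    by move=> i; have [//|A mA gE] := gA i; exists A.
  rewrite [RHS](eq_bigr (fun i => P (X i @^-1` A i))); last first.
    by move=> i _; have [mA ->] := AP i; exact: int_indic.
  have := Xindep [set: I]%SET A (fun i => (AP i).1).
  rewrite [RHS](eq_bigl xpredT) => [<-|i]; last by rewrite !inE.
  rewrite -[X in P X]setIT -integral_indic//; last first.
    by apply: fin_bigcap_measurable => // i _; apply: mX; exact: (AP i).1.
  apply: eq_integral => w _; congr (_%:E).
  rewrite (eq_bigr (fun i => \1_(A i) (X i w))); last first.
    by move=> i _; have [_ ->] := AP i.
  (* A product of indicators is the indicator of the intersection. *)
  rewrite indicE; case: (boolP (w \in _)) => wA /=.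
    rewrite big1// => i _; rewrite indicE mem_set//.
    by move/set_mem: wA => /(_ i); apply; rewrite /= inE.
  apply/eqP/prodf_eq0; apply: contrapT => noi; move/negP: wA; apply.
  apply/mem_set => i _ /=; apply: contrapT => Ai; apply: noi; exists i => //.
  by rewrite indicE memNset.
pose c := (\prod_(i | i != x) \int[P]_w (g i (X i w))%:E)%E.
pose h w := (\prod_(i | i != x) g i (X i w))%:E.
have c0 : (0 <= c)%E.
  by apply: prode_ge0 => i _; apply: integral_ge0 => w _; rewrite lee_fin.
have mgX i : measurable_fun [set: T] (fun w => g i (X i w)).
  by apply: measurableT_comp.
have mh : measurable_fun [set: T] h.
  apply/measurable_EFinP; rewrite /h.
  under eq_fun do rewrite -big_filter; exact: measurable_prod.
have h0 w : (0 <= h w)%E by rewrite lee_fin prodr_ge0.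
transitivity (\int[P]_w ((g x (X x w))%:E * h w))%E.
  by apply: eq_integral => w _; rewrite (bigD1 x)//= EFinM.
rewrite (@ge0_integral_weighted_pushforward _ _ _ _ _ _ _ P P (X x) (X x)
  h (cst c) (EFin \o g x))//=.
- rewrite ge0_integralZr//=.
  + by rewrite [RHS](bigD1 x).
  + exact/measurable_EFinP.
  + by move=> w _; rewrite lee_fin.
(* With the factor at [x] turned into the indicator of [B], the induction hypothesis for [s] applies
   and gives this equality. *)
- move=> B mB; pose g' i := if i == x then \1_B : R -> R else g i.
  transitivity (\int[P]_w (\prod_i g' i (X i w))%:E)%E.
    rewrite integral_mkcond; apply: eq_integral => w _.
    rewrite (bigD1 x)//= /g' eqxx patchE indicE.
    rewrite (_ : (X x w \in B) = (w \in X x @^-1` B)); last first.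
      by apply/idP/idP; rewrite !inE.
    case: ifP => _; rewrite ?mul0r ?mul1r//; congr (_%:E).
    by apply: eq_bigr => i /negbTE ->.
  rewrite IH /g'.
  + rewrite (bigD1 x)//= eqxx int_indic// integral_cst//; last exact: mX.
    rewrite muleC; congr (_ * _)%E.
    by apply: eq_bigr => i /negbTE ->.
  + move=> i is'; case: eqP => [_|/eqP ix]; first by exists B.
    by apply: gA; rewrite inE negb_or ix.
  + by move=> i; case: ifP => _ //; exact: measurable_indic.
  + by move=> i y; case: ifP => _ //; rewrite indicE.
- exact/measurable_EFinP.
- by move=> y; rewrite lee_fin.
Qed.

(** * The Rayleigh density and the moment generating function of the square *)

Lemma rayleigh_pdfE (R : realType) (m : R) :
  rayleigh_pdf m =
  (fun x => 2 * x / m * expR (- (x ^+ 2 / m))) \_ `[0, +oo[%classic.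
Proof.
apply/funext => x; rewrite /rayleigh_pdf patchE; case: ifPn => x0.
  by rewrite mem_set//= in_itv/= x0.
by rewrite memNset//= in_itv/= andbT; exact/negP.
Qed.

Lemma continuous_rayleigh_body (R : realType) (m : R) :
  continuous (fun x : R => 2 * x / m * expR (- (x ^+ 2 / m))).
Proof.
move=> x; apply: differentiable_continuous; apply/derivable1_diffP.
exact: ex_derive.
Qed.

Lemma measurable_rayleigh_pdf (R : realType) (m : R) :
  measurable_fun [set: R] (rayleigh_pdf m).
Proof.
rewrite rayleigh_pdfE; apply/(measurable_restrictT _ _).1 => //.
apply: measurable_funTS; apply: continuous_measurable_fun.
exact: continuous_rayleigh_body.
Qed.

Lemma rayleigh_pdf_ge0 (R : realType) (m x : R) :
  0 <= m -> 0 <= rayleigh_pdf m x.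
Proof.
move=> m0; rewrite /rayleigh_pdf; case: ifP => // x0.
by rewrite mulr_ge0 ?expR_ge0// divr_ge0// mulr_ge0.
Qed.

Lemma integral_rayleigh_pdf (R : realType) (m : R) : 0 < m ->
  (\int[lebesgue_measure]_x (rayleigh_pdf m x)%:E = 1)%E.
Proof.
move=> m0.
transitivity (\int[lebesgue_measure]_(x in `[0%R, +oo[)
    (2 * x / m * expR (- (x ^+ 2 / m)))%:E)%E.
  rewrite [RHS]integral_mkcond; apply: eq_integral => x _.
  by rewrite rayleigh_pdfE !patchE; case: ifP.
have F_derive (x : R) : is_derive x 1 (fun x => - expR (- (x ^+ 2 / m)))
    (2 * x / m * expR (- (x ^+ 2 / m))).
  apply: is_derive_eq.
  by rewrite /GRing.scale/= !mulr1; ring.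
rewrite (@ge0_continuous_FTC2y _ _ (fun x => - expR (- (x ^+ 2 / m))) _ 0).
- by rewrite expr0n/= mul0r oppr0 expR0 -EFinB sub0r opprK.
- by move=> x x0; rewrite mulr_ge0 ?expR_ge0// divr_ge0 ?(ltW m0)// mulr_ge0.
- by apply: continuous_subspaceT; exact: continuous_rayleigh_body.
- rewrite -oppr0; apply: cvgN.
  apply: (@cvg_comp _ _ _ (fun x : R => x ^+ 2 / m) (fun y => expR (- y)) _
    (pinfty_nbhs R)); last exact: cvgr_expR.
  apply/cvgryPge => A; near=> x.
  (* For [x >= 1] and [x >= A * m] one has [A * m <= x <= x * x]. *)
  rewrite ler_pdivlMr// expr2.
  have x1 : 1 <= x by near: x; apply: nbhs_pinfty_ge; rewrite num_real.
  apply: (@le_trans _ _ x); last by rewrite ler_peMl//; lra.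
  by near: x; apply: nbhs_pinfty_ge; rewrite num_real.
- by move=> x _; case: (F_derive x).
- apply: cvg_at_right_filter.
  have : {for 0, continuous (fun x : R => - expR (- (x ^+ 2 / m)))}.
    apply: differentiable_continuous; apply/derivable1_diffP.
    by case: (F_derive 0).
  by [].
- by move=> x _; rewrite derive1E; have [_ ->] := F_derive x.
Unshelve. all: by end_near. Qed.

(** Exponential tilting: [expR (r * x ^+ 2)] times the density with parameter [mu] is
    [(1 - r * mu)^-1] times the Rayleigh density with parameter [mu / (1 - r * mu)], whose total
    mass is [1]. *)
Lemma rayleigh_mgf_sqr (R : realType) (d : measure_display)
    (T : measurableType d) (P : probability T R) (mu r : R)
    (X : {RV P >-> R}) :
  0 < mu -> r * mu < 1 -> is_rayleigh mu X ->
  (\int[P]_w (expR (r * X w ^+ 2))%:E = ((1 - r * mu)^-1)%:E)%E.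
Proof.
move=> mu0 rmu X_rayleigh.
have k0 : 0 < 1 - r * mu by rewrite subr_gt0.
have mE : measurable_fun [set: R] (fun x : R => expR (r * x ^+ 2)).
  apply: measurableT_comp => //.
  by apply: measurable_funM => //; exact: measurable_funX.
transitivity (\int[lebesgue_measure]_x
    ((expR (r * x ^+ 2))%:E * (rayleigh_pdf mu x)%:E))%E.
  transitivity (\int[P]_w ((expR (r * X w ^+ 2))%:E * 1))%E.
    by apply: eq_integral => w _; rewrite mule1.
  apply: (@ge0_integral_weighted_pushforward _ _ _ _ _ _ _ P
    lebesgue_measure X id (cst 1%E) (EFin \o rayleigh_pdf mu)
    (fun x => (expR (r * x ^+ 2))%:E)) => //=.
  - by apply/measurable_EFinP; exact: measurable_rayleigh_pdf.
  - by move=> x; rewrite lee_fin rayleigh_pdf_ge0// ltW.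
  - move=> A mA; rewrite integral_cst ?mul1e; first exact: X_rayleigh.
    by rewrite -[X in measurable X]setTI; exact: measurable_funPT.
  - exact/measurable_EFinP.
transitivity (\int[lebesgue_measure]_x
   (((1 - r * mu)^-1)%:E * (rayleigh_pdf (mu / (1 - r * mu)) x)%:E))%E.
  apply: eq_integral => x _; rewrite -!EFinM; congr (_%:E).
  rewrite /rayleigh_pdf; case: ifP => _; last by rewrite !mulr0.
  rewrite mulrCA -expRD [in RHS]mulrA; congr (_ * expR _).
    by field; rewrite !gt_eqF.
  by field; rewrite !gt_eqF.
rewrite ge0_integralZl_EFin//.
- by rewrite integral_rayleigh_pdf ?mule1// divr_gt0.
- by move=> x _; rewrite lee_fin rayleigh_pdf_ge0// divr_ge0// ltW.
- by apply/measurable_EFinP; exact: measurable_rayleigh_pdf.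
- by rewrite invr_ge0 ltW.
Qed.

(** * Chernoff bound for both tails of the estimator *)

Section estimator.
Context (R : realType) (d : measure_display) (T : measurableType d)
  (P : probability T R) (N : nat) (mu : R) (X : 'I_N -> {RV P >-> R}).

Lemma measurable_second_moment_estimator :
  measurable_fun [set: T] (second_moment_estimator X).
Proof.
apply: measurable_funM => //; apply: measurable_sum => i.
by apply: measurable_funX; exact: measurable_funPT.
Qed.

(** Makes the estimator a random variable, so that a multiple of it can be passed to Chernoff's
    bound. *)
HB.instance Definition _ := isMeasurableFun.Build _ _ _ _
  (second_moment_estimator X) measurable_second_moment_estimator.

(** The factor [u] on both sides of the event treats the two tails at once: for [u > 0] it is the
    upper tail, and for [u < 0] the inequality reverses into the lower one. *)
Lemma second_moment_estimator_tail (u : R) : (0 < N)%N -> 0 < mu ->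
  mutually_independent X -> (forall i, is_rayleigh mu (X i)) -> -1 < u ->
  (P [set w | (u * (mu * (1 + u)) <= u * second_moment_estimator X w)%R] <=
   (((1 + u) * expR (- u)) ^+ N)%:E)%E.
Proof.
move=> N0 mu0 X_indep X_rayleigh uN1.
have u1 : 0 < 1 + u by lra.
have Nr0 : 0 < N%:R :> R by rewrite ltr0n.
(* The minimiser of [(1 - r * mu)^-1 * expR (- (r * mu * (1 + u)))]; it has the sign of [u]. *)
pose r := u / (mu * (1 + u)).
have rmu : 1 - r * mu = (1 + u)^-1 by rewrite /r; field; rewrite !gt_eqF.
pose Y : {RV P >-> R} := (r * N%:R) \o* (second_moment_estimator X).
have -> : [set w | u * (mu * (1 + u)) <= u * second_moment_estimator X w] =
    [set w | Y w >= N%:R * u].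
  apply: eq_set => w /=; congr is_true.
  rewrite -subr_ge0 -[in RHS]subr_ge0.
  set z := second_moment_estimator X w.
  have -> : z * (r * N%:R) - N%:R * u =
      N%:R / (mu * (1 + u)) * (u * z - u * (mu * (1 + u))).
    by rewrite /r; field; rewrite !gt_eqF.
  by rewrite pmulr_rge0// divr_gt0// mulr_gt0.
(* The exponent [r * N%:R] is already built into [Y], hence the parameter [1]. *)
apply: (le_trans (chernoff Y _ ltr01)).
rewrite mul1r /mmt_gen_fun unlock.
rewrite exprMn -(expRM_natl N (- u)) mulrN EFinM.
rewrite lee_pmul2r//; last by rewrite lte_fin expR_gt0.
rewrite (_ : \int[P]_w _ = \int[P]_w (\prod_i expR (r * X i w ^+ 2))%:E)%E.
  rewrite (@expectation_prod_independent _ _ _ _ _ _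
    (fun _ x => expR (r * x ^+ 2)))//.
  - rewrite (eq_bigr (fun=> (1 + u)%:E)); last first.
      move=> i _; rewrite (@rayleigh_mgf_sqr _ _ _ _ mu)//.
        by rewrite rmu invrK.
      by rewrite -subr_gt0 rmu invr_gt0.
    by rewrite prodEFin prodr_const card_ord.
  - move=> _; apply: measurableT_comp => //.
    by apply: measurable_funM => //; exact: measurable_funX.
apply: eq_integral => w _; congr (_%:E).
rewrite -expR_sum -mulr_sumr /= /second_moment_estimator; congr expR.
by field; rewrite gt_eqF.
Qed.
End estimator.

(** * Logarithm inequalities and the resulting rates *)

Lemma is_derive_ge0_le (R : realType) (f f' : R -> R) (a b : R) : a <= b ->
  (forall y, a <= y <= b -> is_derive y 1 f (f' y)) ->
  (forall y, a <= y <= b -> 0 <= f' y) -> f a <= f b.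
Proof.
move=> ab fE f'0; apply: (@ger0_derive1_le_cc _ f a b).
- move=> y; rewrite in_itv/= => /andP[ay yb].
  by have [] := fE y; rewrite ?ltW.
- move=> y; rewrite in_itv/= => /andP[ay yb].
  have yab : a <= y <= b by rewrite !ltW.
  by rewrite derive1E; have [_ ->] := fE y yab; exact: f'0.
- apply: derivable_within_continuous => y; rewrite in_itv/= => yab.
  by have [] := fE y yab.
- by rewrite in_itv/= lexx ab.
- by rewrite in_itv/= lexx ab.
- exact: ab.
Qed.

(** The difference of the two sides vanishes at [0] and has the nonnegative derivative [f']. The
    rational term produces exactly the factor [3 + 2 * eps] in the sample size. *)
Lemma ln1Dx_le (R : realType) (x : R) : 0 <= x ->
  ln (1 + x) <= x - 3 * x ^+ 2 / (2 * (3 + 2 * x)).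
Proof.
move=> x0.
pose f (y : R) := y - 3 * y ^+ 2 / (2 * (3 + 2 * y)) - ln (1 + y).
pose f' (y : R) := y ^+ 3 / ((1 + y) * (3 + 2 * y) ^+ 2).
have f0 : f 0 = 0.
  by rewrite /f /= !(expr0n, mulr0, mul0r, oppr0, addr0, ln1).
rewrite -subr_ge0 -[X in X <= _]f0.
apply: (@is_derive_ge0_le _ f f' _ _ x0) => y /andP[y0 _].
  have ln_d : is_derive (1 + y) 1 (@ln R) (1 + y)^-1.
    by apply: is_derive1_ln; lra.
  have den_neq0 : 2 * (3 + 2 * y) != 0 by rewrite gt_eqF//; lra.
  apply: is_derive_eq.
  rewrite /f' /GRing.scale/= !mulr1 add0r.
  by field; apply/andP; split; rewrite gt_eqF//; lra.
by rewrite divr_ge0 ?exprn_ge0// mulr_ge0 ?exprn_ge0//; lra.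
Qed.

(** The Taylor polynomial of degree 2 dominates; again the difference vanishes at [0] and is
    nondecreasing. *)
Lemma ln1Bx_le (R : realType) (x : R) : 0 <= x < 1 ->
  ln (1 - x) <= - x - x ^+ 2 / 2.
Proof.
move=> /andP[x0 x1].
pose f (y : R) := - y - y ^+ 2 / 2 - ln (1 - y).
pose f' (y : R) := y ^+ 2 / (1 - y).
have f0 : f 0 = 0 by rewrite /f /= !(expr0n, mul0r, oppr0, addr0, ln1).
rewrite -subr_ge0 -[X in X <= _]f0.
apply: (@is_derive_ge0_le _ f f' _ _ x0) => y /andP[y0 yx].
  have ln_d : is_derive (1 - y) 1 (@ln R) (1 - y)^-1.
    by apply: is_derive1_ln; lra.
  apply: is_derive_eq.
  rewrite /f' /GRing.scale/= !mulr1 ?add0r.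
  by field; rewrite gt_eqF//; lra.
by rewrite divr_ge0 ?exprn_ge0//; lra.
Qed.

Lemma estimator_upper_rate (R : realType) (N : nat) (eps delta : R) :
  0 < eps -> 0 < delta ->
  2 * (3 + 2 * eps) * ln (2 / delta) <= 3 * eps ^+ 2 * N%:R ->
  ((1 + eps) * expR (- eps)) ^+ N <= delta / 2.
Proof.
move=> e0 d0 NL.
have e1 : 0 < 1 + eps by lra.
(* Both sides are written as exponentials, [delta / 2] being [expR (- ln (2 / delta))], so that only
   exponents are compared. *)
rewrite -[delta / 2]invf_div -[_ / delta]lnK ?posrE ?divr_gt0// -expRN.
rewrite -[1 + eps]lnK ?posrE// -expRD -expRM_natl ler_expR.
apply: (@le_trans _ _ (N%:R * - (3 * eps ^+ 2 / (2 * (3 + 2 * eps))))).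
  by rewrite ler_wpM2l//; have := @ln1Dx_le _ eps (ltW e0); lra.
rewrite mulrN lerN2 mulrA ler_pdivlMr; last lra.
by rewrite mulrC [_ * (3 * _)]mulrC.
Qed.

Lemma estimator_lower_rate (R : realType) (N : nat) (eps delta : R) :
  (0 < N)%N -> 0 < eps < 1 -> 0 < delta ->
  2 * (3 + 2 * eps) * ln (2 / delta) <= 3 * eps ^+ 2 * N%:R ->
  ((1 - eps) * expR (- - eps)) ^+ N < delta / 2.
Proof.
move=> N0 /andP[e0 e1] d0 NL.
have e'0 : 0 < 1 - eps by lra.
have Nr0 : 0 < N%:R :> R by rewrite ltr0n.
rewrite -[delta / 2]invf_div -[_ / delta]lnK ?posrE ?divr_gt0// -expRN.
rewrite -[1 - eps]lnK ?posrE// -expRD -expRM_natl ltr_expR.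
apply: (@le_lt_trans _ _ (N%:R * - (eps ^+ 2 / 2))).
  have eps01 : 0 <= eps < 1 by rewrite ltW.
  by rewrite ler_wpM2l//; have := @ln1Bx_le _ eps eps01; lra.
rewrite mulrN ltrN2 -(ltr_pM2l (_ : 0 < 2 * (3 + 2 * eps))); last lra.
apply: (le_lt_trans NL); rewrite -subr_gt0.
(* The quadratic bound on the logarithm leaves this surplus over the hypothesis, which makes the
   inequality strict. *)
rewrite (_ : _ - _ = 2 * eps ^+ 3 * N%:R); last by field.
by rewrite !mulr_gt0// exprn_gt0.
Qed.

(** * Coverage probability of the interval *)

Lemma second_moment_estimator_confidence (R : realType) (d : measure_display)
    (T : measurableType d) (P : probability T R) (N : nat) (mu : R)
    (X : 'I_N -> {RV P >-> R}) (eps delta : R) :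
  (0 < N)%N -> 0 < mu ->
  mutually_independent X -> (forall i, is_rayleigh mu (X i)) ->
  0 < eps < 1 -> 0 < delta ->
  2 * (3 + 2 * eps) * ln (2 / delta) <= 3 * eps ^+ 2 * N%:R ->
  ((1 - delta)%:E <
     P [set w | (second_moment_estimator X w / (1 + eps) < mu
                 < second_moment_estimator X w / (1 - eps))%R])%E.
Proof.
move=> N0 mu0 X_indep X_rayleigh /[dup] e01 /andP[e0 e1] d0 NL.
have e'0 : 0 < 1 - eps by lra.
set Z := second_moment_estimator X.
have mZ : measurable_fun [set: T] Z.
  exact: measurable_second_moment_estimator.
set E := [set w | _].
pose A u := [set w | u * (mu * (1 + u)) <= u * Z w].
have mA u : measurable (A u).
  rewrite -[A u]setTI; apply: measurable_fun_le => //.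
  exact: measurable_funM.
(* Coverage fails when [Z >= mu * (1 + eps)] or [Z <= mu * (1 - eps)]. *)
have CE : ~` E = A eps `|` A (- eps).
  apply/seteqP; split => w /=.
    move/negP; rewrite negb_and -!leNgt ler_pdivlMr ?ler_pdivrMr//; last lra.
    by case/orP => h; [left|right]; rewrite /A/= ?mulNr ?lerN2 ler_pM2l.
  move=> h; apply/negP; rewrite negb_and -!leNgt.
  rewrite ler_pdivlMr ?ler_pdivrMr//; last lra.
  by apply/orP; case: h => h; [left|right]; move: h;
    rewrite /A/= ?mulNr ?lerN2 ler_pM2l.
have mE : measurable E.
  by rewrite -[E]setCK CE; apply: measurableC; exact: measurableU.
have tail u := @second_moment_estimator_tail _ _ _ _ _ _ _ u N0 mu0 X_indep
  X_rayleigh.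
have PCE : (P (~` E) < delta%:E)%E.
  rewrite CE; apply: (le_lt_trans (measureU2 _ _ _)) => //.
  (* Each tail receives [delta / 2]; the lower one makes the sum strict. *)
  rewrite (splitr delta) EFinD; apply: lee_ltD => //.
  - by rewrite fin_num_measure.
  - apply: le_trans (tail eps _) _; first lra.
    by rewrite lee_fin; exact: estimator_upper_rate.
  - apply: le_lt_trans (tail (- eps) _) _; first lra.
    by rewrite lte_fin; exact: estimator_lower_rate.
have PE : P E \is a fin_num by exact: fin_num_measure.
move: PCE; rewrite probability_setC// -(fineK PE) -EFinB !lte_fin; lra.
Qed.

Theorem corollary1 (R : realType) (d : measure_display) (T : measurableType d)
    (P : probability T R) (N : nat) (mu : R) (X : 'I_N -> {RV P >-> R})
    (N_gt0 : (0 < N)%N) (mu_gt0 : 0 < mu)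
    (X_indep : mutually_independent X)
    (X_rayleigh : forall i, is_rayleigh mu (X i)) :
  (forall eps delta : R, 0 < eps < 1 -> 0 < delta < 1 ->
     2 * (3 + 2 * eps) * ln (2 / delta) / (3 * eps ^+ 2) < N%:R ->
     ((1 - delta)%:E <
        P [set w | (second_moment_estimator X w / (1 + eps) < mu
                    < second_moment_estimator X w / (1 - eps))%R])%E)
  /\
  (forall eps delta : R, 0 < delta < 1 ->
     10 / 3 * ln (2 / delta) < N%:R ->
     eps = 2 * ln (2 / delta) / (3 * N%:R) *
           (1 + Num.sqrt (1 + 9 * N%:R / (2 * ln (2 / delta)))) ->
     ((1 - delta)%:E <
        P [set w | (second_moment_estimator X w / (1 + eps) < mu
                    < second_moment_estimator X w / (1 - eps))%R])%E).
Proof.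
have conf eps delta := @second_moment_estimator_confidence _ _ _ _ _ _ _ eps
  delta N_gt0 mu_gt0 X_indep X_rayleigh.
have Nr0 : 0 < N%:R :> R by rewrite ltr0n.
split=> [eps delta e01 /andP[d0 d1] NL|eps delta /andP[d0 d1] NL epsE].
  have e0 : 0 < 3 * eps ^+ 2.
    by move: e01 => /andP[e0 _]; rewrite mulr_gt0 ?exprn_gt0.
  apply: conf => //; move: NL; rewrite ltr_pdivrMr// => /ltW.
  by rewrite [N%:R * _]mulrC.
have L0 : 0 < ln (2 / delta).
  by rewrite ln_gt0// ltr_pdivlMr//; lra.
move: epsE; set L := ln (2 / delta) in L0 NL * => epsE.
set s := Num.sqrt _ in epsE.
have s2 : s ^+ 2 = 1 + 9 * N%:R / (2 * L).
  by rewrite sqr_sqrtr// addr_ge0// divr_ge0// mulr_ge0// ltW.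
have s0 : 0 <= s by exact: sqrtr_ge0.
have e0 : 0 < eps.
  by rewrite epsE mulr_gt0// ?divr_gt0 ?mulr_gt0//; lra.
have eps_root : 3 * eps ^+ 2 * N%:R = 2 * (3 + 2 * eps) * L.
  (* Solving the definition of [eps] for the square root turns [s2] into the quadratic equation for
     [eps]. *)
  have sE : s = 3 * N%:R * eps / (2 * L) - 1.
    by rewrite epsE; field; rewrite !gt_eqF.
  apply/eqP; rewrite -subr_eq0; apply/eqP.
  transitivity (4 * L ^+ 2 / (3 * N%:R) * (s ^+ 2 - (1 + 9 * N%:R / (2 * L)))).
    by rewrite sE; field; rewrite !gt_eqF.
  by rewrite s2 subrr mulr0.
apply: conf => //; last by rewrite eps_root.
(* The quadratic takes the value [3 * N%:R - 10 * L > 0] at [1]; the decomposition below shows that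
   it stays positive for [eps >= 1], so its root lies below [1]. *)
rewrite e0 /=; rewrite ltNge; apply/negP => e1.
have NL10 : 0 < eps ^+ 2 * (3 * N%:R - 10 * L).
  by rewrite mulr_gt0 ?exprn_gt0//; lra.
have eL : 0 <= L * ((eps - 1) * (10 * eps + 6)).
  by rewrite !mulr_ge0//; lra.
have : 3 * eps ^+ 2 * N%:R - 2 * (3 + 2 * eps) * L =
    eps ^+ 2 * (3 * N%:R - 10 * L) + L * ((eps - 1) * (10 * eps + 6)) by ring.
rewrite eps_root; lra.
Qed.
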